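(* Let $(V,m)$ be a discrete measure space and $(b,c)$ a locally finite graph over $(V,m)$. Let $L$ be a non-negative selfadjoint operator on $\ell^2(V,m)$ which is a restriction of $\widetilde L$ and whose associated form $Q$ is a Dirichlet form. Then $$Q^{(N)}\le Q\le Q^{(D)}.$$
   Context: $V$ is a finite or countably infinite set and $m:V\to(0,\infty)$; $(V,m)$ is a discrete measure space. $C(V)$ is the set of all functions $V\to\mathbb C$, $C_c(V)$ the finitely supported ones, and $\ell^2(V,m)$ carries $\langle u,v\rangle=\sum_x u(x)\overline{v(x)}m(x)$. A graph over $(V,m)$ is a pair $(b,c)$ with $c:V\to[0,\infty)$, $b:V\times V\to[0,\infty)$, $b(x,x)=0$, $b(x,y)=b(y,x)$, $\sum_y b(x,y)<\infty$; it is locally finite if $\{y:b(x,y)>0\}$ is finite for every $x$. For $u\in C(V)$ (for locally finite graphs all sums below are finite) define $\widetilde L u(x)=\frac{1}{m(x)}\sum_y b(x,y)(u(x)-u(y))+\frac{c(x)}{m(x)}u(x)$; ''$L$ is a restriction of $\widetilde L$'' means $Lu=\widetilde Lu$ on the domain of $L$. $Q^{(N)}$ is the form on $\ell^2(V,m)$ with domain $D(Q^{(N)})=\{u\in\ell^2(V,m):\frac12\sum_{x,y}b(x,y)|u(x)-u(y)|^2+\sum_x c(x)|u(x)|^2<\infty\}$ and $Q^{(N)}(u,v)=\frac12\sum_{x,y}b(x,y)(u(x)-u(y))\overline{(v(x)-v(y))}+\sum_x c(x)u(x)\overline{v(x)}$. $Q^{(D)}$ is the closure of the restriction of $Q^{(N)}$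 to $C_c(V)$. The form associated to a non-negative selfadjoint $L$ is $Q(u,v)=\langle L^{1/2}u,L^{1/2}v\rangle$ on $D(Q)=D(L^{1/2})$. A Dirichlet form is a non-negative closed symmetric form $Q$ such that for every $u\in D(Q)$ and every normal contraction $C:\mathbb C\to\mathbb C$ (i.e. $C(0)=0$, $|C(s)-C(t)|\le|s-t|$) one has $C\circ u\in D(Q)$ and $Q(C\circ u,C\circ u)\le Q(u,u)$. For non-negative forms, $Q_1\le Q_2$ means $D(Q_2)\subseteq D(Q_1)$ and $Q_1(u,u)\le Q_2(u,u)$ for all $u\in D(Q_2)$. *)

(* Defs.v *)
From Stdlib Require Import Reals List.
Open Scope R_scope.

Definition C : Type := (R * R)%type.
Definition RtoC (r : R) : C := (r, 0).
Definition C0 : C := (0, 0).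
Definition Cadd (z w : C) : C := (fst z + fst w, snd z + snd w).
Definition Copp (z : C) : C := (- fst z, - snd z).
Definition Csub (z w : C) : C := Cadd z (Copp w).
Definition Cmul (z w : C) : C :=
  (fst z * fst w - snd z * snd w, fst z * snd w + snd z * fst w).
Definition Cconj (z : C) : C := (fst z, - snd z).
Definition Cnorm2 (z : C) : R := fst z * fst z + snd z * snd z.
Definition Cmod (z : C) : R := sqrt (Cnorm2 z).

Definition sum_list {I : Type} (f : I -> R) (l : list I) : R :=
  fold_right (fun i acc => f i + acc) 0 l.
Definition Csum_list {I : Type} (f : I -> C) (l : list I) : C :=
  fold_right (fun i acc => Cadd (f i) acc) C0 l.

(* [nnsum_le f a] : all finite partial sums of f are <= a
   (for f >= 0 this is  sum_i f i <= a). *)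
Definition nnsum_le {I : Type} (f : I -> R) (a : R) : Prop :=
  forall l : list I, NoDup l -> sum_list f l <= a.
(* [nnsum f a] : a is the supremum of the finite partial sums of f
   (for f >= 0 this is  sum_i f i = a). *)
Definition nnsum {I : Type} (f : I -> R) (a : R) : Prop :=
  nnsum_le f a /\
  forall eps, 0 < eps -> exists l : list I, NoDup l /\ a - eps < sum_list f l.
Definition csums {I : Type} (f : I -> C) (z : C) : Prop :=
  forall eps, 0 < eps -> exists l0 : list I, NoDup l0 /\
    forall l : list I, NoDup l -> incl l0 l -> Cmod (Csub (Csum_list f l) z) < eps.

Definition countable (V : Type) : Prop :=
  exists f : V -> nat, forall x y, f x = f y -> x = y.

Definition is_measure {V : Type} (m : V -> R) : Prop := forall x, 0 < m x.

Definition is_graph {V : Type} (b : V -> V -> R) (c : V -> R) : Prop :=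
  (forall x, 0 <= c x) /\
  (forall x y, 0 <= b x y) /\
  (forall x, b x x = 0) /\
  (forall x y, b x y = b y x) /\
  (forall x, exists a, nnsum_le (b x) a).

Definition locally_finite {V : Type} (b : V -> V -> R) : Prop :=
  forall x, exists l : list V, forall y, 0 < b x y -> In y l.

Definition l2 {V : Type} (m : V -> R) (u : V -> C) : Prop :=
  exists a, nnsum_le (fun x => Cnorm2 (u x) * m x) a.

Definition inner {V : Type} (m : V -> R) (u v : V -> C) (z : C) : Prop :=
  csums (fun x => Cmul (Cmul (u x) (Cconj (v x))) (RtoC (m x))) z.

Definition dist2_le {V : Type} (m : V -> R) (u v : V -> C) (eps : R) : Prop :=
  nnsum_le (fun x => Cnorm2 (Csub (u x) (v x)) * m x) eps.

Definition l2conv {V : Type} (m : V -> R) (us : nat -> V -> C) (u : V -> C) : Prop :=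
  l2 m u /\
  forall eps, 0 < eps -> exists N, forall n, (N <= n)%nat -> dist2_le m (us n) u eps.

Definition fsub {V : Type} (u v : V -> C) : V -> C := fun x => Csub (u x) (v x).

Definition finitely_supported {V : Type} (u : V -> C) : Prop :=
  exists l : list V, forall x, ~ In x l -> u x = C0.

Record operator (V : Type) := mkOp {
  op_dom : (V -> C) -> Prop;
  op_app : (V -> C) -> (V -> C) }.
Arguments op_dom {V}.
Arguments op_app {V}.

(* A selfadjoint operator: densely defined, symmetric, and D(A^* ) ⊆ D(A)
   (with A^* = A there). *)
Definition selfadjoint {V : Type} (m : V -> R) (A : operator V) : Prop :=
  (forall u, op_dom A u -> l2 m u /\ l2 m (op_app A u)) /\
  (forall v, l2 m v -> forall eps, 0 < eps ->
       exists u, op_dom A u /\ dist2_le m u v eps) /\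
  (forall u v z, op_dom A u -> op_dom A v ->
       inner m (op_app A u) v z -> inner m u (op_app A v) z) /\
  (forall v w, l2 m v -> l2 m w ->
       (forall u z, op_dom A u -> inner m (op_app A u) v z -> inner m u w z) ->
       op_dom A v /\ forall x, op_app A v x = w x).

Definition nonneg_op {V : Type} (m : V -> R) (A : operator V) : Prop :=
  forall u z, op_dom A u -> inner m (op_app A u) u z -> 0 <= fst z.

Definition is_sqrt {V : Type} (m : V -> R) (L S : operator V) : Prop :=
  selfadjoint m S /\ nonneg_op m S /\
  (forall u, op_dom L u <-> (op_dom S u /\ op_dom S (op_app S u))) /\
  (forall u, op_dom L u -> forall x, op_app L u x = op_app S (op_app S u) x).

Definition restricts_formal {V : Type} (m : V -> R) (b : V -> V -> R) (c : V -> R)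
    (L : operator V) : Prop :=
  forall u, op_dom L u -> forall x,
    csums (fun y => Cmul (RtoC (b x y)) (Csub (u x) (u y)))
          (Csub (Cmul (RtoC (m x)) (op_app L u x)) (Cmul (RtoC (c x)) (u x))).

Record qform (V : Type) := mkForm {
  f_dom : (V -> C) -> Prop;
  f_val : (V -> C) -> R -> Prop }.  (* f_val u a  <->  Q(u,u) = a *)
Arguments f_dom {V}.
Arguments f_val {V}.

(* Form associated to L:  D(Q) = D(L^{1/2}),  Q(u,u) = ||L^{1/2} u||^2,
   where S = L^{1/2}. *)
Definition assoc_form {V : Type} (m : V -> R) (S : operator V) : qform V :=
  mkForm V (op_dom S)
    (fun u a => nnsum (fun x => Cnorm2 (op_app S u x) * m x) a).

Definition QN_val {V : Type} (b : V -> V -> R) (c : V -> R) (u : V -> C) (a : R) : Prop :=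
  exists a1 a2,
    nnsum (fun p : V * V => / 2 * b (fst p) (snd p) * Cnorm2 (Csub (u (fst p)) (u (snd p)))) a1 /\
    nnsum (fun x => c x * Cnorm2 (u x)) a2 /\
    a = a1 + a2.

Definition QN {V : Type} (m : V -> R) (b : V -> V -> R) (c : V -> R) : qform V :=
  mkForm V (fun u => l2 m u /\ exists a, QN_val b c u a) (QN_val b c).

Definition form_cauchy {V : Type} (Q : qform V) (us : nat -> V -> C) : Prop :=
  forall eps, 0 < eps -> exists N, forall n k, (N <= n)%nat -> (N <= k)%nat ->
    forall a, f_val Q (fsub (us n) (us k)) a -> a < eps.

Definition form_conv {V : Type} (Q : qform V) (us : nat -> V -> C) (u : V -> C) : Prop :=
  forall eps, 0 < eps -> exists N, forall n, (N <= n)%nat ->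
    forall a, f_val Q (fsub (us n) u) a -> a < eps.

(* Q^{(D)}: closure of the restriction of Q^{(N)} to C_c(V). *)
Definition QD {V : Type} (m : V -> R) (b : V -> V -> R) (c : V -> R) : qform V :=
  mkForm V
    (fun u => exists us : nat -> V -> C,
        (forall n, finitely_supported (us n)) /\ l2conv m us u /\
        form_cauchy (QN m b c) us)
    (fun u a => exists us : nat -> V -> C,
        (forall n, finitely_supported (us n)) /\ l2conv m us u /\
        form_cauchy (QN m b c) us /\
        (forall eps, 0 < eps -> exists N, forall n, (N <= n)%nat ->
            forall an, QN_val b c (us n) an -> Rabs (an - a) < eps)).

Definition closed_form {V : Type} (m : V -> R) (Q : qform V) : Prop :=
  (forall u, f_dom Q u -> l2 m u) /\
  (forall u a, f_dom Q u -> f_val Q u a -> 0 <= a) /\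
  (forall (us : nat -> V -> C) u,
      (forall n, f_dom Q (us n)) -> l2conv m us u -> form_cauchy Q us ->
      f_dom Q u /\ form_conv Q us u).

Definition normal_contraction (Cn : C -> C) : Prop :=
  Cn C0 = C0 /\ forall s t, Cmod (Csub (Cn s) (Cn t)) <= Cmod (Csub s t).

Definition dirichlet_form {V : Type} (m : V -> R) (Q : qform V) : Prop :=
  closed_form m Q /\
  forall u Cn, f_dom Q u -> normal_contraction Cn ->
    f_dom Q (fun x => Cn (u x)) /\
    forall a a', f_val Q (fun x => Cn (u x)) a' -> f_val Q u a -> a' <= a.

Definition form_le {V : Type} (Q1 Q2 : qform V) : Prop :=
  forall u, f_dom Q2 u ->
    f_dom Q1 u /\ forall a1 a2, f_val Q1 u a1 -> f_val Q2 u a2 -> a1 <= a2.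

(* Main.v *)
Require Import Defs.
From Stdlib Require Import Reals List.
From Stdlib Require Import Lra Lia Classical ClassicalEpsilon FunctionalExtensionality Permutation FinFun.
Open Scope R_scope.

(** Write [S = L^(1/2)] and [E(u,v) = Re <Su,Sv>].  Testing the adjoint of [L] against point
masses puts [z delta_x] in [D(L)], with [E(z delta_x, w) = Re (z * conj (m L~w)(x))] for all
[w] in [D(S)].  Hence [E] agrees with [Q^(N)] on [C_c(V)], and [Q <= Q^(D)] because [Q] is
closed.

For [Q^(N) <= Q], fix a finite set [K] and split [u = v + w] with [v = 1_K u].  The terms
[E(v,v)] and [E(v,w)] are explicit, and completing squares reduces the bound to
[E(w,w) >= sum_(x in K, y notin K) b(x,y) |w(y)|^2] for [w] vanishing on [K].  One may take
[w >= 0].  Markovianity gives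
[E(w,w) >= E(g,g) + 2 h sum_(x in K, y notin K) b(x,y) g(y)] with [g = (w-h)^+].
Iterating in [h] and letting [h -> 0] turns the linear terms into [|w(y)|^2], as
[w^2 = 2 int_0^oo (w-s)^+ ds]; local finiteness makes the boundary sum finite, so pointwise
convergence suffices. *)

(** * Finite sums *)

Lemma sum_list_app {I} (f : I -> R) l1 l2 :
  sum_list f (l1 ++ l2) = sum_list f l1 + sum_list f l2.
Proof. induction l1 as [|x l IH]; simpl; [lra | rewrite IH; lra]. Qed.

Lemma sum_list_ext {I} (f g : I -> R) l :
  (forall x, In x l -> f x = g x) -> sum_list f l = sum_list g l.
Proof.
  induction l as [|x l IH]; simpl; intros H; [reflexivity|].
  rewrite (H x (or_introl eq_refl)), IH; auto.
Qed.

Lemma sum_list_le {I} (f g : I -> R) l :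
  (forall x, In x l -> f x <= g x) -> sum_list f l <= sum_list g l.
Proof.
  induction l as [|x l IH]; simpl; intros H; [lra|].
  apply Rplus_le_compat; auto.
Qed.

Lemma sum_list_zero {I} (f : I -> R) l :
  (forall x, In x l -> f x = 0) -> sum_list f l = 0.
Proof.
  induction l as [|x l IH]; simpl; intros H; [reflexivity|].
  rewrite (H x (or_introl eq_refl)), IH; auto; lra.
Qed.

Lemma sum_list_nonneg {I} (f : I -> R) l :
  (forall x, In x l -> 0 <= f x) -> 0 <= sum_list f l.
Proof.
  intros H. rewrite <- (sum_list_zero (fun _ : I => 0) l) by auto.
  now apply sum_list_le.
Qed.

Lemma sum_list_axpy {I} (f g : I -> R) r l :
  sum_list (fun x => f x + r * g x) l = sum_list f l + r * sum_list g l.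
Proof. induction l as [|x l IH]; simpl; [lra | rewrite IH; lra]. Qed.

Lemma sum_list_add {I} (f g : I -> R) l :
  sum_list (fun x => f x + g x) l = sum_list f l + sum_list g l.
Proof. induction l as [|x l IH]; simpl; [lra | rewrite IH; lra]. Qed.

Lemma sum_list_scal {I} (f : I -> R) r l :
  sum_list (fun x => r * f x) l = r * sum_list f l.
Proof. induction l as [|x l IH]; simpl; [lra | rewrite IH; lra]. Qed.

Lemma sum_list_exchange {I J} (f : I -> J -> R) k l :
  sum_list (fun x => sum_list (f x) l) k = sum_list (fun y => sum_list (fun x => f x y) k) l.
Proof.
  induction k as [|x k IH]; simpl.
  - symmetry; now apply sum_list_zero.
  - now rewrite IH, sum_list_add.
Qed.

Lemma sum_list_perm {I} (f : I -> R) l1 l2 :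
  Permutation l1 l2 -> sum_list f l1 = sum_list f l2.
Proof.
  induction 1 as [| x l l2 _ IH | x y l | l1 l2 l3 _ IH1 _ IH2]; simpl.
  - reflexivity.
  - now rewrite IH.
  - ring.
  - congruence.
Qed.

Lemma sum_list_prod {I J} (f : I * J -> R) k l :
  sum_list f (list_prod k l) = sum_list (fun x => sum_list (fun y => f (x, y)) l) k.
Proof.
  induction k as [|x k IH]; simpl; [reflexivity|].
  rewrite sum_list_app, IH. f_equal. clear IH.
  induction l as [|y l IHl]; simpl; [reflexivity | now rewrite IHl].
Qed.

Lemma list_bounded {I} (f : I -> R) l : exists B, forall x, In x l -> f x <= B.
Proof.
  induction l as [|a l [B HB]]; [exists 0; simpl; tauto|].
  exists (Rmax (f a) B). intros x [<-|Hx]; [apply Rmax_l|].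
  apply Rle_trans with (2 := Rmax_r _ _). auto.
Qed.

(** Equality on [I] need not be decidable, so membership is decided classically. This turns lists
    into finite sets: unions, common refinements and complements all come from here. *)
Lemma NoDup_complement {I} (k l : list I) :
  NoDup k -> exists k', NoDup (k ++ k') /\
    forall x, In x (k ++ k') <-> In x k \/ In x l.
Proof.
  intros Hk. induction l as [|a l [k' [Hd Hi]]].
  - exists nil. rewrite app_nil_r. split; [assumption | simpl; tauto].
  - destruct (classic (In a (k ++ k'))) as [Ha|Ha].
    + exists k'. split; [assumption|]. intros x. rewrite Hi. simpl.
      split; [tauto|]. intros [?|[<-|?]]; [tauto | now apply Hi | tauto].
    + exists (a :: k'). split.
      * now apply (Permutation_NoDup (Permutation_middle k k' a)), NoDup_cons.
      * intros x. generalize (Hi x). rewrite !in_app_iff. simpl. tauto.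
Qed.

Lemma NoDup_list {I} (l : list I) :
  exists k, NoDup k /\ forall x, In x k <-> In x l.
Proof.
  destruct (NoDup_complement nil l (NoDup_nil _)) as [k [H1 H2]].
  exists k. split; [assumption|]. intros x. rewrite (H2 x). simpl. tauto.
Qed.

Lemma incl_complement {I} (k l : list I) :
  NoDup k -> NoDup l -> incl k l -> exists k', NoDup (k ++ k') /\ Permutation l (k ++ k').
Proof.
  intros Hk Hl H. destruct (NoDup_complement k l Hk) as [k' [H1 H2]].
  exists k'. split; [assumption|]. apply NoDup_Permutation; auto.
  intros x. rewrite H2. generalize (H x). tauto.
Qed.

Lemma NoDup_app_disjoint {I} (k l : list I) x :
  NoDup (k ++ l) -> In x k -> In x l -> False.
Proof.
  induction k as [|a k IH]; simpl; [tauto|].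
  intros H; inversion_clear H as [|? ? Ha Hd]. intros [->|Hx] Hl; [|now apply IH].
  apply Ha, in_or_app; tauto.
Qed.

Lemma NoDup_list_prod {I J} (k : list I) (l : list J) :
  NoDup k -> NoDup l -> NoDup (list_prod k l).
Proof.
  intros Hk Hl. induction Hk as [|x k Hx Hk IH]; simpl; [constructor|].
  apply NoDup_app; [|assumption|].
  - apply FinFun.Injective_map_NoDup; [|assumption]. intros y z E. now injection E.
  - intros [y z] H1 H2. apply in_map_iff in H1. destruct H1 as [w [E _]].
    injection E as <- _. apply in_prod_iff in H2. tauto.
Qed.

Lemma sum_list_incl_le {I} (f : I -> R) k l :
  (forall x, 0 <= f x) -> NoDup k -> NoDup l -> incl k l -> sum_list f k <= sum_list f l.
Proof.
  intros Hf Hk Hl H. destruct (incl_complement k l Hk Hl H) as [k' [_ Hp]].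
  rewrite (sum_list_perm f _ _ Hp), sum_list_app.
  assert (0 <= sum_list f k') by (apply sum_list_nonneg; auto). lra.
Qed.

Lemma sum_list_incl_eq {I} (f : I -> R) k l :
  (forall x, ~ In x k -> f x = 0) -> NoDup k -> NoDup l -> incl k l ->
  sum_list f k = sum_list f l.
Proof.
  intros Hf Hk Hl H. destruct (incl_complement k l Hk Hl H) as [k' [Hd Hp]].
  rewrite (sum_list_perm f _ _ Hp), sum_list_app, (sum_list_zero f k'); [lra|].
  intros x Hx. apply Hf. intros Hx'. exact (NoDup_app_disjoint k k' x Hd Hx' Hx).
Qed.

(** * Unordered sums *)

(** The real counterpart of [csums]: convergence along the net of finite subsets. It is compatible
    with linear combinations of terms of any sign, while suprema of partial sums ([nnsum]) are
    not. *)
Definition rsums {I} (f : I -> R) (z : R) : Prop :=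
  forall eps, 0 < eps -> exists l0 : list I, NoDup l0 /\
    forall l : list I, NoDup l -> incl l0 l -> Rabs (sum_list f l - z) < eps.

Lemma rsums_unique {I} (f : I -> R) z w : rsums f z -> rsums f w -> z = w.
Proof.
  intros Hz Hw. destruct (Req_dec z w) as [|Hn]; [assumption|exfalso].
  assert (He : 0 < Rabs (z - w) / 2) by (apply Rdiv_lt_0_compat; [apply Rabs_pos_lt|]; lra).
  destruct (Hz _ He) as [l1 [_ H1]]. destruct (Hw _ He) as [l2 [_ H2]].
  destruct (NoDup_list (l1 ++ l2)) as [l [Hd Hl]].
  assert (I1 : incl l1 l) by (intros x Hx; apply Hl, in_or_app; tauto).
  assert (I2 : incl l2 l) by (intros x Hx; apply Hl, in_or_app; tauto).
  specialize (H1 l Hd I1). specialize (H2 l Hd I2).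
  revert H1 H2. unfold Rabs; repeat destruct Rcase_abs; lra.
Qed.

Lemma rsums_ext {I} (f g : I -> R) z : (forall x, f x = g x) -> rsums f z -> rsums g z.
Proof. intros H. now replace g with f by (apply functional_extensionality; auto). Qed.

Lemma rsums_axpy {I} (f g : I -> R) r z w :
  rsums f z -> rsums g w -> rsums (fun x => f x + r * g x) (z + r * w).
Proof.
  intros Hf Hg eps He.
  (* The added [1] keeps the division below legitimate when [r = 0]. *)
  assert (Hr : 0 < Rabs r + 1) by (generalize (Rabs_pos r); lra).
  destruct (Hf (eps / 2)) as [l1 [_ H1]]; [lra|].
  destruct (Hg (eps / 2 / (Rabs r + 1))) as [l2 [_ H2]]; [apply Rdiv_lt_0_compat; lra|].
  destruct (NoDup_list (l1 ++ l2)) as [l0 [Hd Hl]].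
  exists l0. split; [assumption|]. intros l Hdl Hi.
  assert (I1 : incl l1 l) by (intros x Hx; apply Hi, Hl, in_or_app; tauto).
  assert (I2 : incl l2 l) by (intros x Hx; apply Hi, Hl, in_or_app; tauto).
  specialize (H1 l Hdl I1). specialize (H2 l Hdl I2).
  rewrite sum_list_axpy.
  replace (_ - _) with ((sum_list f l - z) + r * (sum_list g l - w)) by ring.
  apply Rle_lt_trans with (1 := Rabs_triang _ _). rewrite Rabs_mult.
  assert (Rabs r * Rabs (sum_list g l - w) <= eps / 2); [|lra].
  apply Rle_trans with ((Rabs r + 1) * Rabs (sum_list g l - w)).
  - generalize (Rabs_pos (sum_list g l - w)). lra.
  - replace (eps / 2) with ((Rabs r + 1) * (eps / 2 / (Rabs r + 1))) by (field; lra).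
    apply Rmult_le_compat_l; lra.
Qed.

Lemma rsums_finite {I} (f : I -> R) l :
  NoDup l -> (forall x, ~ In x l -> f x = 0) -> rsums f (sum_list f l).
Proof.
  intros Hd Hf eps He. exists l. split; [assumption|]. intros k Hk Hi.
  rewrite <- (sum_list_incl_eq f l k Hf Hd Hk Hi).
  rewrite Rminus_diag, Rabs_R0. assumption.
Qed.

Lemma rsums_zero {I} : rsums (fun _ : I => 0) 0.
Proof. apply (rsums_finite (fun _ : I => 0) nil); [constructor | auto]. Qed.

Lemma nnsum_rsums {I} (f : I -> R) a :
  (forall x, 0 <= f x) -> nnsum f a -> rsums f a.
Proof.
  intros Hf [H1 H2] eps He. destruct (H2 eps He) as [l0 [Hd Hl]].
  exists l0. split; [assumption|]. intros l Hdl Hi.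
  generalize (H1 l Hdl) (sum_list_incl_le f l0 l Hf Hd Hdl Hi). intros.
  apply Rabs_def1; lra.
Qed.

Lemma rsums_nnsum {I} (f : I -> R) a :
  (forall x, 0 <= f x) -> rsums f a -> nnsum f a.
Proof.
  intros Hf H. split.
  - intros l Hd. apply Rnot_lt_le. intros Hlt.
    destruct (H (sum_list f l - a)) as [l0 [_ H0]]; [lra|].
    destruct (NoDup_list (l0 ++ l)) as [k [Hk Hl]].
    assert (I1 : incl l0 k) by (intros x Hx; apply Hl, in_or_app; tauto).
    assert (I2 : incl l k) by (intros x Hx; apply Hl, in_or_app; tauto).
    specialize (H0 k Hk I1). generalize (sum_list_incl_le f l k Hf Hd Hk I2).
    generalize (Rle_abs (sum_list f k - a)). lra.
  - intros eps He. destruct (H eps He) as [l0 [Hd H0]]. exists l0.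
    split; [assumption|]. specialize (H0 l0 Hd (incl_refl _)).
    apply Rabs_def2 in H0. lra.
Qed.

(** Completeness of [R]: the supremum of the finite partial sums is the sum. *)
Lemma nnsum_le_exists {I} (f : I -> R) a : nnsum_le f a -> exists s, nnsum f s /\ s <= a.
Proof.
  intros H.
  destruct (completeness (fun s => exists l, NoDup l /\ s = sum_list f l)) as [s [Hub Hlub]].
  - exists a. intros s [l [Hd ->]]. auto.
  - exists 0, nil. split; [constructor | reflexivity].
  - exists s. split; [split|].
    + intros l Hd. apply Hub. eauto.
    + intros eps He. apply NNPP. intros Hn.
      assert (s <= s - eps); [|lra]. apply Hlub. intros t [l [Hd ->]].
      apply Rnot_lt_le. intros Hlt. apply Hn. eauto.
    + apply Hlub. intros t [l [Hd ->]]. auto.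
Qed.

(** * The real inner product of [l2] *)

Definition re_prod (z w : Defs.C) : R := fst z * fst w + snd z * snd w.
(** Multiplication by the imaginary unit. The imaginary part of [<u,v>] is the real inner product of
    [u] with [rot v], so complex identities become pairs of real ones. *)
Definition rot {V} (u : V -> Defs.C) : V -> Defs.C := fun x => (- snd (u x), fst (u x)).
Definition axpy {V} (u : V -> Defs.C) (r : R) (v : V -> Defs.C) : V -> Defs.C :=
  fun x => (fst (u x) + r * fst (v x), snd (u x) + r * snd (v x)).
(** The real part of [<u,v>], made a total function by choice; the value is meaningful where the sum
    converges. *)
Definition re_inner {V} (m : V -> R) (u v : V -> Defs.C) : R :=
  epsilon (inhabits 0) (rsums (fun x => re_prod (u x) (v x) * m x)).

Lemma Cnorm2_ge0 z : 0 <= Cnorm2 z.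
Proof. unfold Cnorm2. nra. Qed.

Lemma fsub_axpy {V} (u v : V -> Defs.C) : fsub u v = axpy u (-1) v.
Proof.
  apply functional_extensionality; intros x. unfold fsub, axpy, Csub, Cadd, Copp; simpl.
  f_equal; ring.
Qed.

Section L2.
Context {V : Type} {m : V -> R} (Hm : is_measure m).

Lemma re_inner_eq u v a :
  rsums (fun x => re_prod (u x) (v x) * m x) a -> re_inner m u v = a.
Proof.
  intros H. apply (rsums_unique (fun x => re_prod (u x) (v x) * m x)); [|assumption].
  unfold re_inner. apply epsilon_spec. eauto.
Qed.

(** Pointwise, [2|u|^2 + 2r^2|v|^2 - |u + rv|^2 = |u - rv|^2 >= 0]. *)
Lemma l2_axpy u r v : l2 m u -> l2 m v -> l2 m (axpy u r v).
Proof.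
  intros [a Ha] [b Hb]. exists (2 * a + 2 * r ^ 2 * b). intros l Hd.
  apply Rle_trans with
    (sum_list (fun x => 2 * (Cnorm2 (u x) * m x) + 2 * r ^ 2 * (Cnorm2 (v x) * m x)) l).
  - apply sum_list_le. intros x _. unfold axpy, Cnorm2; simpl.
    generalize (Hm x). generalize (m x). intros t Ht.
    apply Rminus_le. replace (_ - _) with
      (- (((fst (u x) - r * fst (v x)) ^ 2 + (snd (u x) - r * snd (v x)) ^ 2) * t)) by ring.
    assert (0 <= ((fst (u x) - r * fst (v x)) ^ 2 + (snd (u x) - r * snd (v x)) ^ 2) * t); [|lra].
    apply Rmult_le_pos; [apply Rplus_le_le_0_compat; apply pow2_ge_0 | lra].
  - rewrite sum_list_axpy, sum_list_scal.
    specialize (Ha l Hd). specialize (Hb l Hd). generalize (pow2_ge_0 r). intros.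
    assert (r ^ 2 * sum_list (fun x => Cnorm2 (v x) * m x) l <= r ^ 2 * b)
      by now apply Rmult_le_compat_l.
    lra.
Qed.

Lemma l2_rot u : l2 m u -> l2 m (rot u).
Proof.
  intros [a Ha]. exists a. intros l Hd. eapply Rle_trans; [|exact (Ha l Hd)].
  apply sum_list_le. intros. unfold rot, Cnorm2; simpl. right. ring.
Qed.

Lemma l2_finite u l : (forall x, ~ In x l -> u x = C0) -> l2 m u.
Proof.
  intros Hu. destruct (NoDup_list l) as [k [Hk Hl]].
  exists (sum_list (fun x => Cnorm2 (u x) * m x) k). apply rsums_nnsum.
  - intros x. apply Rmult_le_pos; [apply Cnorm2_ge0 | apply Rlt_le, Hm].
  - apply rsums_finite; [assumption|]. intros x Hx. rewrite Hl in Hx.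
    rewrite (Hu x Hx). unfold Cnorm2, C0; simpl; ring.
Qed.

Lemma l2_norm_rsums u : l2 m u -> exists a, rsums (fun x => re_prod (u x) (u x) * m x) a.
Proof.
  intros [a Ha]. destruct (nnsum_le_exists _ _ Ha) as [s [Hs _]]. exists s.
  apply nnsum_rsums; [|exact Hs].
  intros x. apply Rmult_le_pos; [apply Cnorm2_ge0 | apply Rlt_le, Hm].
Qed.

(** Polarization: the mixed sum is a quarter of the difference of the sums for [u + v] and [u - v],
    both of which converge. *)
Lemma re_inner_spec u v :
  l2 m u -> l2 m v -> rsums (fun x => re_prod (u x) (v x) * m x) (re_inner m u v).
Proof.
  intros Hu Hv. unfold re_inner. apply epsilon_spec.
  destruct (l2_norm_rsums _ (l2_axpy u 1 v Hu Hv)) as [p Hp].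
  destruct (l2_norm_rsums _ (l2_axpy u (-1) v Hu Hv)) as [q Hq].
  exists (0 + / 4 * (p + -1 * q)).
  eapply rsums_ext; [|exact (rsums_axpy _ _ (/ 4) _ _ rsums_zero (rsums_axpy _ _ (-1) _ _ Hp Hq))].
  intros x. unfold axpy, re_prod; simpl. field.
Qed.

Lemma re_inner_comm u v : re_inner m u v = re_inner m v u.
Proof.
  unfold re_inner. f_equal. f_equal. apply functional_extensionality. intros x.
  unfold re_prod; ring.
Qed.

Lemma re_inner_axpy_l u r v w :
  l2 m u -> l2 m v -> l2 m w ->
  re_inner m (axpy u r v) w = re_inner m u w + r * re_inner m v w.
Proof.
  intros Hu Hv Hw. apply re_inner_eq.
  eapply rsums_ext; [|exact (rsums_axpy _ _ r _ _ (re_inner_spec u w Hu Hw) (re_inner_spec v w Hv Hw))].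
  intros x. unfold axpy, re_prod; simpl. ring.
Qed.

Lemma re_inner_axpy_r u r v w :
  l2 m u -> l2 m v -> l2 m w ->
  re_inner m w (axpy u r v) = re_inner m w u + r * re_inner m w v.
Proof.
  intros. rewrite !(re_inner_comm w). now apply re_inner_axpy_l.
Qed.

Lemma re_inner_finite_r u v l :
  NoDup l -> (forall x, ~ In x l -> v x = C0) ->
  re_inner m u v = sum_list (fun x => re_prod (u x) (v x) * m x) l.
Proof.
  intros Hd Hv. apply re_inner_eq, rsums_finite; [assumption|].
  intros x Hx. rewrite (Hv x Hx). unfold re_prod, C0; simpl; ring.
Qed.

Lemma nnsum_re_inner u : l2 m u -> nnsum (fun x => Cnorm2 (u x) * m x) (re_inner m u u).
Proof.
  intros Hu. apply rsums_nnsum; [|exact (re_inner_spec u u Hu Hu)].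
  intros x. apply Rmult_le_pos; [apply Cnorm2_ge0 | apply Rlt_le, Hm].
Qed.

Lemma nnsum_unique {I} (f : I -> R) a a' : nnsum f a -> nnsum f a' -> a = a'.
Proof.
  assert (H : forall a a', nnsum f a -> nnsum f a' -> a <= a').
  { intros s t [_ Hs] [Ht _]. apply Rnot_lt_le. intros Hlt.
    destruct (Hs (s - t)) as [l [Hd Hl]]; [lra|]. specialize (Ht l Hd). lra. }
  intros; apply Rle_antisym; auto.
Qed.

Lemma re_inner_pos u : l2 m u -> 0 <= re_inner m u u.
Proof. intros Hu. exact (proj1 (nnsum_re_inner u Hu) nil (NoDup_nil _)). Qed.

Lemma Csum_list_pair {I} (f : I -> Defs.C) l :
  Csum_list f l = (sum_list (fun x => fst (f x)) l, sum_list (fun x => snd (f x)) l).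
Proof. induction l as [|x l IH]; simpl; [reflexivity | now rewrite IH]. Qed.

Lemma Cmod_bounds z e : Cmod z < e -> Rabs (fst z) < e /\ Rabs (snd z) < e.
Proof.
  unfold Cmod, Cnorm2. intros H.
  split; (eapply Rle_lt_trans; [|exact H]); rewrite <- sqrt_Rsqr_abs; apply sqrt_le_1_alt;
    unfold Rsqr; nra.
Qed.

Lemma Cmod_lt z e : Rabs (fst z) < e / 2 -> Rabs (snd z) < e / 2 -> Cmod z < e.
Proof.
  intros H1 H2. assert (0 < e) by (generalize (Rabs_pos (fst z)); lra).
  unfold Cmod, Cnorm2. rewrite <- (sqrt_Rsqr e) by lra. apply sqrt_lt_1_alt.
  apply Rabs_def2 in H1, H2. unfold Rsqr. nra.
Qed.

Lemma csums_iff {I} (f : I -> Defs.C) z :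
  csums f z <-> rsums (fun x => fst (f x)) (fst z) /\ rsums (fun x => snd (f x)) (snd z).
Proof.
  split.
  - intros H. split; intros eps He; destruct (H eps He) as [l0 [Hd Hl]];
      exists l0; (split; [assumption|]); intros l Hdl Hi; specialize (Hl l Hdl Hi);
      apply Cmod_bounds in Hl; rewrite Csum_list_pair in Hl;
      unfold Csub, Cadd, Copp in Hl; simpl in Hl; apply Hl.
  - intros [H1 H2] eps He.
    destruct (H1 (eps / 2)) as [l1 [_ K1]]; [lra|].
    destruct (H2 (eps / 2)) as [l2 [_ K2]]; [lra|].
    destruct (NoDup_list (l1 ++ l2)) as [l0 [Hd Hl]].
    exists l0. split; [assumption|]. intros l Hdl Hi. rewrite Csum_list_pair.
    apply Cmod_lt; [apply K1 | apply K2]; auto; intros x Hx; apply Hi, Hl, in_or_app; tauto.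
Qed.

Lemma inner_iff u v z :
  l2 m u -> l2 m v -> (inner m u v z <-> z = (re_inner m u v, re_inner m u (rot v))).
Proof.
  intros Hu Hv. unfold inner. rewrite csums_iff.
  assert (H1 := re_inner_spec u v Hu Hv).
  assert (H2 := re_inner_spec u (rot v) Hu (l2_rot v Hv)).
  assert (E1 : (fun x => fst (Cmul (Cmul (u x) (Cconj (v x))) (RtoC (m x)))) =
               (fun x => re_prod (u x) (v x) * m x)).
  { apply functional_extensionality. intros x.
    unfold Cmul, Cconj, RtoC, re_prod; simpl; ring. }
  assert (E2 : (fun x => snd (Cmul (Cmul (u x) (Cconj (v x))) (RtoC (m x)))) =
               (fun x => re_prod (u x) (rot v x) * m x)).
  { apply functional_extensionality. intros x.
    unfold Cmul, Cconj, RtoC, re_prod, rot; simpl; ring. }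
  rewrite E1, E2. split.
  - intros [K1 K2]. rewrite (surjective_pairing z). f_equal.
    + exact (rsums_unique _ _ _ K1 H1).
    + exact (rsums_unique _ _ _ K2 H2).
  - intros ->. auto.
Qed.

(** * Self-adjoint operators *)

Lemma rot_axpy u r (v : V -> Defs.C) : rot (axpy u r v) = axpy (rot u) r (rot v).
Proof.
  apply functional_extensionality. intros x. unfold rot, axpy; simpl. f_equal; ring.
Qed.

Lemma selfadjoint_sym A u v :
  selfadjoint m A -> op_dom A u -> op_dom A v ->
  re_inner m (op_app A u) v = re_inner m u (op_app A v) /\
  re_inner m (op_app A u) (rot v) = re_inner m u (rot (op_app A v)).
Proof.
  intros [H1 [_ [H3 _]]] Hu Hv.
  destruct (H1 u Hu) as [Lu LAu]. destruct (H1 v Hv) as [Lv LAv].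
  assert (H := H3 u v _ Hu Hv (proj2 (inner_iff _ _ _ LAu Lv) eq_refl)).
  apply inner_iff in H; auto. now injection H.
Qed.

(** Maximality of a selfadjoint operator in real terms: whatever passes the adjoint test lies in the
    domain. This is the way in which concrete functions are placed in domains. *)
Lemma selfadjoint_intro A v w :
  selfadjoint m A -> l2 m v -> l2 m w ->
  (forall u, op_dom A u -> re_inner m (op_app A u) v = re_inner m u w /\
     re_inner m (op_app A u) (rot v) = re_inner m u (rot w)) ->
  op_dom A v /\ op_app A v = w.
Proof.
  intros [H1 [_ [_ H4]]] Hv Hw H. destruct (H4 v w Hv Hw) as [Hd He].
  - intros u z Hu Hz. destruct (H1 u Hu) as [Lu LAu].
    apply inner_iff in Hz; auto. apply inner_iff; auto.
    destruct (H u Hu) as [<- <-]. exact Hz.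
  - split; [assumption|]. now apply functional_extensionality.
Qed.

(** Linearity is not part of the record [operator]. It follows from maximality, since by symmetry a
    combination of domain elements passes the adjoint test. *)
Lemma selfadjoint_axpy A u r v :
  selfadjoint m A -> op_dom A u -> op_dom A v ->
  op_dom A (axpy u r v) /\ op_app A (axpy u r v) = axpy (op_app A u) r (op_app A v).
Proof.
  intros HA Hu Hv. assert (H1 := proj1 HA).
  destruct (H1 u Hu) as [Lu LAu]. destruct (H1 v Hv) as [Lv LAv].
  apply selfadjoint_intro; auto using l2_axpy.
  intros f Hf. destruct (H1 f Hf) as [Lf LAf].
  destruct (selfadjoint_sym A f u HA Hf Hu) as [E1 E2].
  destruct (selfadjoint_sym A f v HA Hf Hv) as [E3 E4].
  rewrite !rot_axpy, !re_inner_axpy_r by auto using l2_rot.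
  rewrite E1, E2, E3, E4. auto.
Qed.

End L2.

(** * The formal Laplacian on finitely supported functions *)

Definition delta {V} (x : V) (z : Defs.C) : V -> Defs.C :=
  fun y => if excluded_middle_informative (y = x) then z else C0.

Definition Rscal (r : R) (z : Defs.C) : Defs.C := (r * fst z, r * snd z).

(* The list [nb] stands for the neighbours of [x]. *)
Definition Ldelta {V} (m : V -> R) (b : V -> V -> R) (c : V -> R) (x : V) (nb : list V)
    (z : Defs.C) : V -> Defs.C :=
  fun y => if excluded_middle_informative (y = x) then Rscal ((sum_list (b x) nb + c x) / m x) z
           else Rscal (- b x y / m y) z.

(** If [nb] lists all neighbours of [x] once, this is [m(x)] times the real part of
    [(L~u)(x) * conj z]. *)
Definition flux {V} (b : V -> V -> R) (c : V -> R) (nb : list V) (u : V -> Defs.C) (x : V)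
    (z : Defs.C) : R :=
  sum_list (fun y => b x y * re_prod (Csub (u x) (u y)) z) nb + c x * re_prod (u x) z.

Section Graph.
Context {V : Type} {m : V -> R} {b : V -> V -> R} {c : V -> R} {L S : operator V}
  (Hm : is_measure m) (Hg : is_graph b c) (Hlf : locally_finite b)
  (HL : selfadjoint m L) (Hr : restricts_formal m b c L) (HS : is_sqrt m L S).

Definition energy (u v : V -> Defs.C) : R := re_inner m (op_app S u) (op_app S v).

Lemma S_selfadjoint : selfadjoint m S.
Proof. exact (proj1 HS). Qed.

Lemma S_l2 u : op_dom S u -> l2 m u /\ l2 m (op_app S u).
Proof. exact (proj1 S_selfadjoint u). Qed.

Lemma b_eq0 x nb y : (forall y, 0 < b x y -> In y nb) -> ~ In y nb -> b x y = 0.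
Proof.
  intros H Hy. destruct (proj1 (proj2 Hg) x y) as [Hp|Hp]; [|auto]. elim Hy; auto.
Qed.

Lemma neighbours x : exists nb, NoDup (x :: nb) /\ forall y, 0 < b x y -> In y nb.
Proof.
  destruct (Hlf x) as [l Hl].
  destruct (NoDup_complement (x :: nil) l) as [nb [Hd Hi]]; [repeat constructor; auto|].
  exists nb. split; [exact Hd|]. intros y Hy.
  destruct (proj2 (Hi y) (or_intror (Hl y Hy))) as [<-|]; [|assumption].
  (* The remaining case is [y = x], excluded because [b x x = 0]. *)
  rewrite (proj1 (proj2 (proj2 Hg))) in Hy. lra.
Qed.

Lemma flux_indep x nb nb' u z :
  NoDup nb -> NoDup nb' -> (forall y, 0 < b x y -> In y nb) -> (forall y, 0 < b x y -> In y nb') ->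
  flux b c nb u x z = flux b c nb' u x z.
Proof.
  intros Hd Hd' Hb Hb'. unfold flux. f_equal.
  eapply rsums_unique; apply rsums_finite; auto; intros y Hy.
  - rewrite (b_eq0 x nb y) by auto. ring.
  - rewrite (b_eq0 x nb' y) by auto. ring.
Qed.

Lemma L_flux x nb u z :
  NoDup nb -> (forall y, 0 < b x y -> In y nb) -> op_dom L u ->
  re_prod (op_app L u x) z * m x = flux b c nb u x z.
Proof.
  intros Hd Hb Hu. assert (H := Hr u Hu x). apply csums_iff in H. destruct H as [H1 H2].
  (* Weighting the real part by [fst z] and the imaginary part by [snd z] gives the real part of the
     product with [conj z]. *)
  assert (H := rsums_axpy _ _ (snd z) _ _ (rsums_axpy _ _ (fst z) _ _ rsums_zero H1) H2).
  apply (rsums_ext _ (fun y => b x y * re_prod (Csub (u x) (u y)) z)) in H.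
  2: { intros y. unfold re_prod, Cmul, Csub, Cadd, Copp, RtoC; simpl. ring. }
  assert (K : rsums (fun y => b x y * re_prod (Csub (u x) (u y)) z)
                (sum_list (fun y => b x y * re_prod (Csub (u x) (u y)) z) nb)).
  { apply rsums_finite; [assumption|]. intros y Hy. rewrite (b_eq0 x nb y); auto; ring. }
  unfold flux. rewrite (rsums_unique _ _ _ K H).
  unfold re_prod, Cmul, Csub, Cadd, Copp, RtoC; simpl. ring.
Qed.

Lemma delta_eq (x : V) (z : Defs.C) : delta x z x = z.
Proof. unfold delta. destruct (excluded_middle_informative (x = x)); tauto. Qed.

Lemma delta_neq (x y : V) (z : Defs.C) : y <> x -> delta x z y = C0.
Proof. unfold delta. destruct (excluded_middle_informative (y = x)); tauto. Qed.

Lemma rot_delta (x : V) z : rot (delta x z) = delta x (- snd z, fst z).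
Proof.
  apply functional_extensionality; intros y. unfold rot, delta, C0.
  destruct (excluded_middle_informative (y = x)); simpl; [reflexivity | now rewrite Ropp_0].
Qed.

Lemma rot_Ldelta x nb z : rot (Ldelta m b c x nb z) = Ldelta m b c x nb (- snd z, fst z).
Proof.
  apply functional_extensionality; intros y. unfold rot, Ldelta, Rscal.
  destruct (excluded_middle_informative (y = x)); simpl; f_equal; ring.
Qed.

Lemma re_inner_delta u x z : re_inner m u (delta x z) = re_prod (u x) z * m x.
Proof.
  rewrite (re_inner_finite_r u (delta x z) (x :: nil)).
  - simpl. rewrite delta_eq. ring.
  - repeat constructor; auto.
  - intros y Hy. apply delta_neq. intros ->. apply Hy. simpl; auto.
Qed.

Lemma Ldelta_supp x nb z y :
  (forall y, 0 < b x y -> In y nb) -> ~ In y (x :: nb) -> Ldelta m b c x nb z y = C0.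
Proof.
  intros Hb Hy. unfold Ldelta, Rscal, C0.
  destruct (excluded_middle_informative (y = x)) as [->|_]; [elim Hy; simpl; auto|].
  rewrite (b_eq0 x nb y) by (auto; intros K; apply Hy; simpl; auto).
  f_equal; unfold Rdiv; ring.
Qed.

(** Green's formula for a point mass: the weights [m] cancel the denominators, and the terms regroup
    into the differences [u(x) - u(y)]. *)
Lemma re_inner_Ldelta u x nb z :
  NoDup (x :: nb) -> (forall y, 0 < b x y -> In y nb) ->
  re_inner m u (Ldelta m b c x nb z) = flux b c nb u x z.
Proof.
  intros Hd Hb. assert (Hx := Hm x).
  rewrite (re_inner_finite_r u _ (x :: nb) Hd (fun y => Ldelta_supp x nb z y Hb)).
  inversion_clear Hd as [|? ? Hn _]. simpl.
  rewrite (sum_list_ext _ (fun y => b x y * (- re_prod (u y) z)) nb).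
  - unfold Ldelta at 1. destruct (excluded_middle_informative (x = x)) as [_|K]; [|tauto].
    unfold flux.
    rewrite (sum_list_ext (fun y => b x y * re_prod (Csub (u x) (u y)) z)
      (fun y => b x y * (- re_prod (u y) z) + re_prod (u x) z * b x y)).
    + rewrite sum_list_axpy. unfold re_prod, Rscal; simpl. field. lra.
    + intros y _. unfold re_prod, Csub, Cadd, Copp; simpl. ring.
  - intros y Hy. assert (Hmy := Hm y). unfold Ldelta.
    destruct (excluded_middle_informative (y = x)) as [->|_]; [tauto|].
    unfold re_prod, Rscal; simpl. field. lra.
Qed.

(** By local finiteness [L~(z delta_x)] is finitely supported, hence in l2. In the adjoint test both
    sides equal the flux of [u] at [x], because [L] acts as [L~]; [rot] replaces [z] by [iz] and
    covers the imaginary parts. *)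
Lemma L_delta x nb z :
  NoDup (x :: nb) -> (forall y, 0 < b x y -> In y nb) ->
  op_dom L (delta x z) /\ op_app L (delta x z) = Ldelta m b c x nb z.
Proof.
  intros Hd Hb. assert (Hd' := proj2 (proj1 (NoDup_cons_iff _ _) Hd)).
  apply (selfadjoint_intro Hm); auto.
  - apply (l2_finite Hm _ (x :: nil)). intros y Hy. apply delta_neq.
    intros ->. apply Hy. simpl; auto.
  - apply (l2_finite Hm _ (x :: nb)). intros y Hy. now apply Ldelta_supp.
  - intros u Hu. rewrite rot_delta, rot_Ldelta, !re_inner_delta, !re_inner_Ldelta by assumption.
    now rewrite !(L_flux x nb).
Qed.

(** * The energy product of the square root *)

Lemma energy_L u w : op_dom L u -> op_dom S w -> energy u w = re_inner m (op_app L u) w.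
Proof.
  intros Hu Hw. destruct HS as [HSa [_ [H1 H2]]].
  destruct (proj1 (H1 u) Hu) as [K1 K2].
  rewrite (functional_extensionality _ _ (H2 u Hu)).
  symmetry. exact (proj1 (selfadjoint_sym Hm S _ _ HSa K2 Hw)).
Qed.

Lemma L_dom_S u : op_dom L u -> op_dom S u.
Proof. destruct HS as [_ [_ [H _]]]. intros Hu. now apply H. Qed.

Lemma S_axpy u r v : op_dom S u -> op_dom S v ->
  op_dom S (axpy u r v) /\ op_app S (axpy u r v) = axpy (op_app S u) r (op_app S v).
Proof. exact (selfadjoint_axpy Hm S u r v S_selfadjoint). Qed.

Lemma energy_comm u v : energy u v = energy v u.
Proof. apply re_inner_comm. Qed.

Lemma energy_axpy_l u r v w : op_dom S u -> op_dom S v -> op_dom S w ->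
  energy (axpy u r v) w = energy u w + r * energy v w.
Proof.
  intros Hu Hv Hw. unfold energy. rewrite (proj2 (S_axpy u r v Hu Hv)).
  apply (re_inner_axpy_l Hm); now apply S_l2.
Qed.

Lemma energy_axpy_r u r v w : op_dom S u -> op_dom S v -> op_dom S w ->
  energy w (axpy u r v) = energy w u + r * energy w v.
Proof. intros. rewrite !(energy_comm w). now apply energy_axpy_l. Qed.

Lemma energy_axpy u r v : op_dom S u -> op_dom S v ->
  energy (axpy u r v) (axpy u r v) = energy u u + 2 * r * energy u v + r ^ 2 * energy v v.
Proof.
  intros Hu Hv. assert (H := proj1 (S_axpy u r v Hu Hv)).
  rewrite energy_axpy_l, !energy_axpy_r, (energy_comm v u) by assumption. ring.
Qed.

Lemma energy_pos u : op_dom S u -> 0 <= energy u u.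
Proof. intros Hu. apply (re_inner_pos Hm). now apply S_l2. Qed.

Lemma assoc_form_val u a : op_dom S u -> (f_val (assoc_form m S) u a <-> a = energy u u).
Proof.
  intros Hu. assert (H := nnsum_re_inner Hm _ (proj2 (S_l2 u Hu))). simpl. split.
  - intros Ha. exact (nnsum_unique _ _ _ Ha H).
  - intros ->. exact H.
Qed.

Lemma S_zero : op_dom S (fun _ : V => C0) /\ op_app S (fun _ => C0) = fun _ => C0.
Proof.
  assert (E : forall u : V -> Defs.C, re_inner m u (fun _ => C0) = 0).
  { intros u. rewrite (re_inner_finite_r u _ nil); auto. constructor. }
  assert (Z : rot (fun _ : V => C0) = fun _ => C0).
  { apply functional_extensionality; intros x. unfold rot, C0; simpl. now rewrite Ropp_0. }
  assert (Hl : l2 m (fun _ => C0)) by (apply (l2_finite Hm _ nil); auto).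
  apply (selfadjoint_intro Hm); auto using S_selfadjoint.
  intros u _. rewrite Z, !E. auto.
Qed.

(** Induction on the support, splitting off one point mass at a time. [flux_indep] allows one common
    list [nb] to serve every point of [K]. *)
Lemma energy_finite_support K nb phi :
  NoDup K -> NoDup nb -> (forall x, ~ In x K -> phi x = C0) ->
  (forall x y, In x K -> 0 < b x y -> In y nb) ->
  op_dom S phi /\ forall w, op_dom S w ->
    energy phi w = sum_list (fun x => flux b c nb w x (phi x)) K.
Proof.
  intros HK Hnb. revert phi. induction K as [|x K IH]; intros phi Hp Hb.
  - replace phi with (fun _ : V => C0)
      by (apply functional_extensionality; intros y; symmetry; auto).
    destruct S_zero as [H1 H2]. split; [exact H1|].
    intros w _. simpl. unfold energy. rewrite H2, re_inner_comm.
    rewrite (re_inner_finite_r _ _ nil); auto; constructor.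
  - inversion_clear HK as [|? ? Hx HK'].
    (* [psi] is [phi] with its value at [x] erased, so it is supported in the shorter list. *)
    set (psi := fun y => if excluded_middle_informative (y = x) then C0 else phi y).
    assert (Hpsi : forall y, y <> x -> psi y = phi y).
    { intros y Hy. unfold psi. destruct (excluded_middle_informative (y = x)); tauto. }
    assert (Hpsix : psi x = C0).
    { unfold psi. destruct (excluded_middle_informative (x = x)); tauto. }
    destruct (IH HK' psi) as [D1 E1].
    { intros y Hy. destruct (classic (y = x)) as [->|Hn]; [assumption|].
      rewrite Hpsi by assumption. apply Hp. simpl. intros [->|]; tauto. }
    { intros y z Hy. apply Hb. simpl; auto. }
    destruct (neighbours x) as [nx [Hdx Hbx]].
    destruct (L_delta x nx (phi x) Hdx Hbx) as [D2 E2].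
    assert (D2' := L_dom_S _ D2).
    assert (Ephi : phi = axpy (delta x (phi x)) 1 psi).
    { apply functional_extensionality; intros y. unfold axpy.
      destruct (classic (y = x)) as [->|Hn].
      - rewrite delta_eq, Hpsix. unfold C0; simpl.
        rewrite (surjective_pairing (phi x)) at 1. f_equal; ring.
      - rewrite delta_neq, Hpsi by assumption. unfold C0; simpl.
        rewrite (surjective_pairing (phi y)) at 1. f_equal; ring. }
    split.
    + rewrite Ephi. now apply S_axpy.
    + intros w Hw. rewrite Ephi at 1. rewrite energy_axpy_l by assumption.
      rewrite E1 by assumption. simpl. rewrite Rmult_1_l. f_equal.
      * rewrite energy_L, E2, re_inner_comm, re_inner_Ldelta by assumption.
        apply flux_indep; auto.
        -- now apply NoDup_cons_iff in Hdx.
        -- intros y Hy. apply (Hb x); simpl; auto.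
      * apply sum_list_ext. intros y Hy. rewrite Hpsi; [reflexivity|].
        intros ->. tauto.
Qed.

(** * The energy of finitely supported functions *)

(** Summation by parts: average each term with the one where [x] and [y] are exchanged, using
    [b x y = b y x]. *)
Lemma sum_list_symmetrize (g : V -> Defs.C) l :
  sum_list (fun x => sum_list (fun y => b x y * re_prod (Csub (g x) (g y)) (g x)) l) l =
  sum_list (fun x => sum_list (fun y => / 2 * b x y * Cnorm2 (Csub (g x) (g y))) l) l.
Proof.
  set (F := fun x y => b x y * re_prod (Csub (g x) (g y)) (g x)).
  transitivity (sum_list (fun x => sum_list (fun y => / 2 * F x y) l) l +
                sum_list (fun x => sum_list (fun y => / 2 * F y x) l) l).
  - rewrite (sum_list_exchange (fun x y => / 2 * F y x)).
    rewrite <- sum_list_add. apply sum_list_ext. intros x _.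
    rewrite <- sum_list_add. apply sum_list_ext. intros y _. unfold F. field.
  - rewrite <- sum_list_add. apply sum_list_ext. intros x _.
    rewrite <- sum_list_add. apply sum_list_ext. intros y _. unfold F.
    rewrite (proj1 (proj2 (proj2 (proj2 Hg))) y x).
    unfold re_prod, Cnorm2, Csub, Cadd, Copp; simpl. field.
Qed.

(** [K'] serves as the outer boundary of [K]. It may contain further points, but these have weight
    zero towards [K]. *)
Lemma neighbours_list K : NoDup K -> exists K', NoDup (K ++ K') /\
  forall x y, In x K -> 0 < b x y -> In y (K ++ K').
Proof.
  intros HK.
  assert (H : exists nb, forall x y, In x K -> 0 < b x y -> In y nb).
  { clear HK. induction K as [|x K [nb IH]]; [exists nil; simpl; tauto|].
    destruct (Hlf x) as [l Hl]. exists (l ++ nb). intros z y [<-|Hz] Hb; apply in_or_app; eauto. }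
  destruct H as [nb Hnb]. destruct (NoDup_complement K nb HK) as [K' [Hd Hi]].
  exists K'. split; [assumption|]. intros x y Hx Hb. apply Hi. eauto.
Qed.

Lemma QN_finite_support phi : finitely_supported phi ->
  op_dom S phi /\ QN_val b c phi (energy phi phi).
Proof.
  intros [l Hl]. destruct (NoDup_list l) as [K [HK HKl]].
  assert (Hphi : forall x, ~ In x K -> phi x = C0) by (intros x Hx; apply Hl; now rewrite <- HKl).
  destruct (neighbours_list K HK) as [K' [HM Hnb]]. set (M := K ++ K') in *.
  assert (HKM : incl K M) by (intros x Hx; apply in_or_app; auto).
  destruct (energy_finite_support K M phi HK HM Hphi Hnb) as [Hd He].
  assert (Z : forall z, re_prod z C0 = 0) by (intros z; unfold re_prod, C0; simpl; ring).
  destruct Hg as [Hc [Hb [Hbx [Hsym _]]]].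
  split; [assumption|]. rewrite (He phi Hd).
  (* The outer sum is enlarged from [K] to [M] by zero terms, so that the double sum runs over a
     square and can be symmetrized. *)
  rewrite (sum_list_incl_eq _ K M).
  2: { intros x Hx. rewrite (Hphi x Hx). unfold flux. rewrite Z, sum_list_zero; [ring|].
       intros y _. rewrite Z. ring. }
  2-4: assumption.
  unfold flux. rewrite sum_list_add, sum_list_symmetrize.
  do 2 eexists. split; [|split; [|reflexivity]].
  - apply rsums_nnsum.
    { intros [x y]; simpl. assert (0 <= b x y * Cnorm2 (Csub (phi x) (phi y))); [|lra].
      apply Rmult_le_pos; [apply Hb | apply Cnorm2_ge0]. }
    rewrite <- (sum_list_prod (fun p => / 2 * b (fst p) (snd p) *
                                 Cnorm2 (Csub (phi (fst p)) (phi (snd p))))).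
    apply rsums_finite; [now apply NoDup_list_prod|].
    intros [x y] Hxy; simpl. rewrite in_prod_iff in Hxy.
    (* A pair outside [M x M] contributes nothing: if one point lies in [K], the other is not a
       neighbour of it; if neither does, [phi] vanishes at both. *)
    destruct (classic (In x K)) as [Hx|Hx].
    { rewrite (b_eq0 x M y); [ring | eauto |]. intros Hy. apply Hxy. auto. }
    destruct (classic (In y K)) as [Hy|Hy].
    { rewrite Hsym, (b_eq0 y M x); [ring | eauto |]. intros Hx'. apply Hxy. auto. }
    rewrite (Hphi x Hx), (Hphi y Hy). unfold Cnorm2, Csub, Cadd, Copp, C0; simpl. ring.
  - apply rsums_nnsum.
    { intros x. apply Rmult_le_pos; [apply Hc | apply Cnorm2_ge0]. }
    apply rsums_finite; [assumption|].
    intros x Hx. rewrite (Hphi x); [unfold re_prod, C0; simpl; ring|].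
    intros Hx'. apply Hx, HKM, Hx'.
Qed.

(** * Comparison with the closure from finitely supported functions *)

Lemma finitely_supported_fsub (u v : V -> Defs.C) :
  finitely_supported u -> finitely_supported v -> finitely_supported (fsub u v).
Proof.
  intros [k Hk] [l Hl]. exists (k ++ l). intros x Hx. rewrite in_app_iff in Hx.
  unfold fsub. rewrite (Hk x), (Hl x) by tauto.
  unfold Csub, Cadd, Copp, C0; simpl. f_equal; ring.
Qed.

(** Differences of the [us n] are finitely supported, where both forms agree. So a Cauchy sequence
    for [QN] is Cauchy for the form of [S], and closedness applies. *)
Lemma form_conv_finite us u : closed_form m (assoc_form m S) ->
  (forall n, finitely_supported (us n)) -> l2conv m us u -> form_cauchy (QN m b c) us ->
  op_dom S u /\ forall eps, 0 < eps -> exists N, forall n, (N <= n)%nat ->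
    energy (fsub (us n) u) (fsub (us n) u) < eps.
Proof.
  intros [_ [_ Hcl]] Hf Hc Hq. destruct (Hcl us u) as [Hd Hconv]; auto.
  - intros n. now apply QN_finite_support.
  - intros eps He. destruct (Hq eps He) as [N HN]. exists N. intros n k Hn Hk a Ha.
    destruct (QN_finite_support _ (finitely_supported_fsub _ _ (Hf n) (Hf k))) as [Hd HQ].
    apply assoc_form_val in Ha; [subst a | assumption]. exact (HN n k Hn Hk _ HQ).
  - split; [exact Hd|]. intros eps He. destruct (Hconv eps He) as [N HN].
    exists N. intros n Hn. apply (HN n Hn). apply assoc_form_val; [|reflexivity].
    rewrite fsub_axpy. apply S_axpy; [now apply QN_finite_support | exact Hd].
Qed.

Lemma assoc_form_le_QD : closed_form m (assoc_form m S) ->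
  form_le (assoc_form m S) (QD m b c).
Proof.
  intros Hcl u [us [Hf [Hc Hq]]].
  destruct (form_conv_finite us u Hcl Hf Hc Hq) as [Hd _]. split; [exact Hd|].
  (* [QD] provides domain membership and the value through separate sequences; the comparison of
     values needs the second one. *)
  clear us Hf Hc Hq. intros a1 a Ha1 [us [Hf [Hc [Hq Hv]]]].
  apply assoc_form_val in Ha1; [subst a1 | assumption].
  destruct (form_conv_finite us u Hcl Hf Hc Hq) as [_ Hconv].
  apply Rnot_lt_le. intros Hlt. set (E := energy u u) in *.
  assert (HE : 0 <= E) by now apply energy_pos.
  set (d := E - a). assert (Hdp : 0 < d) by (unfold d; lra).
  (* The weight [t] makes [t E <= d/3], and [E(w,w) < t d/3] is requested below. Then
     [-2 E(u,w) < 2d/3], while the value at [us n] is below [a + d/3]; together [E < a + d],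
     contradicting [d = E - a]. *)
  set (t := d / 3 / (E + 1)).
  assert (Ht : 0 < t) by (apply Rdiv_lt_0_compat; lra).
  assert (HtE : t * E <= d / 3).
  { replace (d / 3) with (t * (E + 1)) by (unfold t; field; lra). nra. }
  destruct (Hconv (t * (d / 3))) as [N1 H1]; [apply Rmult_lt_0_compat; lra|].
  destruct (Hv (d / 3)) as [N2 H2]; [lra|].
  set (n := (N1 + N2)%nat). specialize (H1 n ltac:(lia)). specialize (H2 n ltac:(lia)).
  destruct (QN_finite_support (us n) (Hf n)) as [Hn Hval].
  specialize (H2 _ Hval). apply Rabs_def2 in H2.
  rewrite fsub_axpy in H1. set (w := axpy (us n) (-1) u) in *.
  assert (Hw : op_dom S w) by now apply S_axpy.
  assert (Eu : us n = axpy u 1 w).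
  { apply functional_extensionality; intros x. unfold w, axpy; simpl.
    rewrite (surjective_pairing (us n x)) at 1. f_equal; ring. }
  rewrite Eu, energy_axpy in H2 by assumption.
  (* Cauchy-Schwarz in the form [- 2 t E(u,w) <= E(w,w) + t^2 E(u,u)] *)
  assert (K : 0 <= energy (axpy w t u) (axpy w t u)) by now apply energy_pos, S_axpy.
  rewrite energy_axpy, (energy_comm w u) in K by assumption.
  fold E in H2, K. assert (Hw0 := energy_pos w Hw).
  assert (t * (2 * energy u w) > t * (- (d / 3) - d / 3)) by nra.
  assert (2 * energy u w > - (d / 3) - d / 3) by (apply Rmult_lt_reg_l with t; lra).
  unfold d in *. lra.
Qed.

(** * Truncation and the killing at the boundary of a finite set *)

Definition of_real (f : V -> R) : V -> Defs.C := fun x => (f x, 0).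

Definition indicator (K : list V) (x : V) : R :=
  if excluded_middle_informative (In x K) then 1 else 0.

Lemma indicator_in K x : In x K -> indicator K x = 1.
Proof. unfold indicator. destruct (excluded_middle_informative (In x K)); tauto. Qed.

Lemma indicator_out K x : ~ In x K -> indicator K x = 0.
Proof. unfold indicator. destruct (excluded_middle_informative (In x K)); tauto. Qed.

Lemma Cmod_ge0 z : 0 <= Cmod z.
Proof. apply sqrt_pos. Qed.

Lemma Cmod_sq z : Cmod z * Cmod z = Cnorm2 z.
Proof. apply sqrt_sqrt, Cnorm2_ge0. Qed.

Lemma Cmod_of_real_le s z : s * s <= Cnorm2 z -> Cmod (s, 0) <= Cmod z.
Proof. intros H. apply sqrt_le_1_alt. unfold Cnorm2 at 1; simpl. lra. Qed.

(** Taking the real part does not increase distances, so composing it with a real contraction gives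
    a normal one. *)
Lemma real_contraction rho : rho 0 = 0 -> (forall s t, Rabs (rho s - rho t) <= Rabs (s - t)) ->
  normal_contraction (fun z => (rho (fst z), 0)).
Proof.
  intros H0 H. split; [unfold C0; simpl; now rewrite H0|]. intros s t.
  unfold Csub at 1, Cadd, Copp; simpl. rewrite Ropp_0, Rplus_0_l.
  apply Cmod_of_real_le. specialize (H (fst s) (fst t)).
  apply Rsqr_le_abs_1 in H. unfold Rsqr in H.
  unfold Cnorm2, Csub, Cadd, Copp; simpl. generalize (Rle_0_sqr (snd s + - snd t)). unfold Rsqr. lra.
Qed.

Lemma Cmod_contraction : normal_contraction (fun z => (Cmod z, 0)).
Proof.
  split.
  { unfold Cmod, Cnorm2, C0; simpl. now rewrite Rmult_0_l, Rplus_0_l, sqrt_0. }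
  intros s t. unfold Csub at 1, Cadd, Copp; simpl. rewrite Ropp_0, Rplus_0_l.
  apply Cmod_of_real_le.
  assert (Hs := Cmod_sq s). assert (Ht := Cmod_sq t).
  assert (Hs0 := Cmod_ge0 s). assert (Ht0 := Cmod_ge0 t).
  assert (H : re_prod s t <= Cmod s * Cmod t).
  { apply Rsqr_incr_0_var; [|now apply Rmult_le_pos]. unfold Rsqr.
    replace (Cmod s * Cmod t * (Cmod s * Cmod t)) with (Cnorm2 s * Cnorm2 t)
      by (rewrite <- Hs, <- Ht; ring).
    (* Lagrange's identity: this square equals [|s|^2 |t|^2] minus the square of [re_prod s t]. *)
    assert (K := Rle_0_sqr (fst s * snd t - snd s * fst t)).
    unfold Rsqr in K. unfold re_prod, Cnorm2. nra. }
  replace (_ * _) with (Cnorm2 s - 2 * (Cmod s * Cmod t) + Cnorm2 t)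
    by (rewrite <- Hs, <- Ht; ring).
  replace (Cnorm2 (Csub s t)) with (Cnorm2 s - 2 * re_prod s t + Cnorm2 t)
    by (unfold Cnorm2, re_prod, Csub, Cadd, Copp; simpl; ring).
  lra.
Qed.

(** * Consequences of the Markov property *)

Context (HD : dirichlet_form m (assoc_form m S)).

Lemma energy_contraction u Cn : op_dom S u -> normal_contraction Cn ->
  op_dom S (fun x => Cn (u x)) /\
  energy (fun x => Cn (u x)) (fun x => Cn (u x)) <= energy u u.
Proof.
  intros Hu HC. destruct (proj2 HD u Cn Hu HC) as [Hd H]. split; [exact Hd|].
  apply H; now apply assoc_form_val.
Qed.

(** The integral of [f] over [K'] against the killing weight created by the edges into [K]. *)
Definition boundary_sum (K K' : list V) (f : V -> R) : R :=
  sum_list (fun x => sum_list (fun y => b x y * f y) K') K.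

Lemma boundary_sum_le K K' f g :
  (forall y, In y K' -> f y <= g y) -> boundary_sum K K' f <= boundary_sum K K' g.
Proof.
  intros H. apply sum_list_le; intros x _. apply sum_list_le; intros y Hy.
  apply Rmult_le_compat_l; [apply Hg | auto].
Qed.

Lemma boundary_sum_axpy K K' f g r :
  boundary_sum K K' (fun y => f y + r * g y) = boundary_sum K K' f + r * boundary_sum K K' g.
Proof.
  unfold boundary_sum. rewrite <- sum_list_axpy. apply sum_list_ext; intros x _.
  rewrite <- sum_list_axpy. apply sum_list_ext; intros y _. ring.
Qed.

(** As [g] vanishes on [K], the potential and the edges inside [K] contribute nothing; a boundary
    edge contributes [- b(x,y) g(y)]. *)
Lemma energy_indicator K K' g :
  NoDup (K ++ K') -> (forall x y, In x K -> 0 < b x y -> In y (K ++ K')) ->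
  (forall x, In x K -> g x = 0) -> op_dom S (of_real g) ->
  op_dom S (of_real (indicator K)) /\
  energy (of_real (indicator K)) (of_real g) = - boundary_sum K K' g.
Proof.
  intros Hd Hnb Hg0 HgS.
  destruct (energy_finite_support K (K ++ K') (of_real (indicator K))) as [H1 H2]; auto.
  { now apply NoDup_app_remove_r in Hd. }
  { intros x Hx. unfold of_real. now rewrite indicator_out. }
  split; [assumption|]. rewrite (H2 _ HgS).
  transitivity (-1 * boundary_sum K K' g); [|ring].
  unfold boundary_sum. rewrite <- sum_list_scal.
  apply sum_list_ext. intros x Hx. unfold flux, of_real.
  rewrite sum_list_app, (sum_list_zero _ K).
  - rewrite <- sum_list_scal, (Hg0 x Hx), (indicator_in K x Hx).
    unfold re_prod at 2; simpl. rewrite Rmult_0_l, Rmult_0_r, !Rplus_0_l, Rmult_0_r, Rplus_0_r.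
    apply sum_list_ext. intros y _. unfold re_prod, Csub, Cadd, Copp; simpl. ring.
  - intros y Hy. rewrite (Hg0 x Hx), (Hg0 y Hy). unfold re_prod, Csub, Cadd, Copp; simpl. ring.
Qed.

(* The function [f = min(v,h) + h 1_K] is fixed by truncating [f + e (v-h)^+] at height [h],
   so the Markov property forces [<f, (v-h)^+> >= 0] in the energy product. *)
Lemma energy_truncation K K' v h :
  NoDup (K ++ K') -> (forall x y, In x K -> 0 < b x y -> In y (K ++ K')) ->
  0 < h -> (forall x, 0 <= v x) -> (forall x, In x K -> v x = 0) -> op_dom S (of_real v) ->
  let g x := Rmax (v x - h) 0 in
  op_dom S (of_real g) /\
  energy (of_real g) (of_real g) + 2 * h * boundary_sum K K' g <=
    energy (of_real v) (of_real v).
Proof.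
  intros Hd Hnb Hh Hv0 HvK HvS g.
  assert (HgS : op_dom S (of_real g)).
  { apply (energy_contraction (of_real v) (fun z => (Rmax (fst z - h) 0, 0)) HvS).
    apply (real_contraction (fun t => Rmax (t - h) 0)).
    - apply Rmax_right. lra.
    - intros s t. unfold Rmax, Rabs. repeat destruct Rle_dec; repeat destruct Rcase_abs; lra. }
  split; [assumption|].
  assert (HgK : forall x, In x K -> g x = 0).
  { intros x Hx. unfold g. rewrite (HvK x Hx). apply Rmax_right. lra. }
  destruct (energy_indicator K K' g Hd Hnb HgK HgS) as [HoS Ho].
  (* [w = v - g = min(v,h)]. *)
  set (w := axpy (of_real v) (-1) (of_real g)).
  assert (HwS : op_dom S w) by now apply S_axpy.
  set (f := axpy w h (of_real (indicator K))).
  assert (HfS : op_dom S f) by now apply S_axpy.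
  assert (Hfg : 0 <= energy f (of_real g)).
  { assert (Hpos := energy_pos _ HgS).
    assert (Hstep : forall e, 0 < e ->
      0 <= 2 * e * energy f (of_real g) + e ^ 2 * energy (of_real g) (of_real g)).
    { intros e He.
      destruct (energy_contraction (axpy f e (of_real g)) (fun z => (Rmin (fst z) h, 0)))
        as [_ Hle].
      - now apply S_axpy.
      - apply (real_contraction (fun t => Rmin t h)).
        + apply Rmin_left. lra.
        + intros s t. unfold Rmin, Rabs. repeat destruct Rle_dec; repeat destruct Rcase_abs; lra.
      - replace (fun x => (Rmin (fst (axpy f e (of_real g) x)) h, 0)) with f in Hle.
        + rewrite energy_axpy in Hle by assumption. lra.
        + apply functional_extensionality. intros x.
          unfold f, w, axpy, of_real; simpl. f_equal; [|ring].
          destruct (classic (In x K)) as [Hx|Hx].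
          * rewrite indicator_in, (HvK x Hx), (HgK x Hx) by assumption.
            rewrite Rmin_right; lra.
          * rewrite indicator_out by assumption. unfold g, Rmax.
            destruct Rle_dec; [rewrite Rmin_left; lra|].
            rewrite Rmin_right; [lra|]. assert (0 < e * (v x - h)) by nra. lra. }
    (* If [F < 0], then [e = -F/(G+1)] gives [2F + eG = F - e < 0], against [Hstep]. The [1] guards
       against [G = 0]. *)
    apply Rnot_lt_le. intros Hneg.
    set (G := energy (of_real g) (of_real g)) in *. set (F := energy f (of_real g)) in *.
    specialize (Hstep (- F / (G + 1))). assert (He : 0 < - F / (G + 1)) by (apply Rdiv_lt_0_compat; lra).
    specialize (Hstep He). set (e := - F / (G + 1)) in *.
    assert (Ee : e * (G + 1) = - F) by (unfold e; field; lra). nra. }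
  (* This reads [E(w,g) >= h * boundary_sum K K' g]. Expanding [v = w + g] and dropping
     [E(w,w) >= 0] finishes. *)
  unfold f in Hfg. rewrite energy_axpy_l, Ho in Hfg by assumption.
  replace (of_real v) with (axpy w 1 (of_real g)).
  2: { apply functional_extensionality. intros x. unfold w, axpy, of_real; simpl. f_equal; ring. }
  rewrite energy_axpy by assumption. assert (Hw := energy_pos w HwS). lra.
Qed.

(** [N] counts the layers of height [h] that exhaust [v] on [K']; each truncation removes one. With
    [g = (v-h)^+] the gain telescopes: [g(g-h) + 2hg] equals [v(v-h)] where [v >= h], and
    [v(v-h) <= 0] where [v < h]. *)
Lemma energy_truncation_iter K K' h N v :
  NoDup (K ++ K') -> (forall x y, In x K -> 0 < b x y -> In y (K ++ K')) ->
  0 < h -> (forall x, 0 <= v x) -> (forall x, In x K -> v x = 0) -> op_dom S (of_real v) ->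
  (forall y, In y K' -> v y <= INR N * h) ->
  boundary_sum K K' (fun y => v y * (v y - h)) <= energy (of_real v) (of_real v).
Proof.
  intros Hd Hnb Hh. revert v. induction N as [|N IH]; intros v Hv0 HvK HvS Hb.
  - apply Rle_trans with 0; [|now apply energy_pos].
    right. apply sum_list_zero. intros x _. apply sum_list_zero. intros y Hy.
    specialize (Hb y Hy). specialize (Hv0 y). simpl in Hb.
    replace (v y) with 0 by lra. ring.
  - destruct (energy_truncation K K' v h) as [HgS Hle]; auto.
    set (g := fun x => Rmax (v x - h) 0) in *.
    assert (Hg0 : forall x, 0 <= g x) by (intros x; apply Rmax_r).
    apply Rle_trans with (2 := Hle).
    apply Rle_trans with (boundary_sum K K' (fun y => g y * (g y - h)) + 2 * h * boundary_sum K K' g).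
    + rewrite <- boundary_sum_axpy. apply boundary_sum_le. intros y _.
      unfold g, Rmax. specialize (Hv0 y). destruct Rle_dec; nra.
    + apply Rplus_le_compat_r, IH; auto.
      * intros x Hx. unfold g. rewrite (HvK x Hx). apply Rmax_right. lra.
      * intros y Hy. specialize (Hb y Hy). rewrite S_INR in Hb. unfold g.
        apply Rmax_lub; [lra|]. apply Rmult_le_pos; [apply pos_INR | lra].
Qed.

(** Passing to [|w|] lowers the energy and keeps the boundary sum of squares. The layer estimate
    then loses only [h] times a finite boundary sum, and [h] is arbitrary. *)
Lemma energy_boundary K K' w :
  NoDup (K ++ K') -> (forall x y, In x K -> 0 < b x y -> In y (K ++ K')) ->
  (forall x, In x K -> w x = C0) -> op_dom S w ->
  boundary_sum K K' (fun y => Cnorm2 (w y)) <= energy w w.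
Proof.
  intros Hd Hnb HwK Hw. destruct (energy_contraction w _ Hw Cmod_contraction) as [HvS Hle].
  apply Rle_trans with (2 := Hle). set (v := fun x => Cmod (w x)).
  change (fun x => (Cmod (w x), 0)) with (of_real v) in *.
  assert (Hv0 : forall x, 0 <= v x) by (intros x; apply Cmod_ge0).
  assert (HvK : forall x, In x K -> v x = 0).
  { intros x Hx. unfold v. rewrite (HwK x Hx). exact (f_equal fst (proj1 Cmod_contraction)). }
  assert (Hlim : forall h, 0 < h -> boundary_sum K K' (fun y => Cnorm2 (w y)) - h * boundary_sum K K' v
                   <= energy (of_real v) (of_real v)).
  (* Finiteness of [K'] bounds [v] there, so finitely many layers of height [h] suffice. *)
  { intros h Hh. destruct (list_bounded v K') as [B HB].
    destruct (INR_unbounded (B / h)) as [N HN].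
    apply Rle_trans with (boundary_sum K K' (fun y => v y * (v y - h))).
    - right. unfold Rminus. rewrite <- Ropp_mult_distr_l_reverse, <- boundary_sum_axpy.
      f_equal. apply functional_extensionality. intros y. rewrite <- Cmod_sq. unfold v. ring.
    - apply energy_truncation_iter with N; auto. intros y Hy.
      apply Rle_trans with (1 := HB y Hy). apply Rmult_gt_compat_r with (r := h) in HN; [|lra].
      replace (B / h * h) with B in HN by (field; lra). lra. }
  assert (HB : 0 <= boundary_sum K K' v).
  { apply sum_list_nonneg; intros x _. apply sum_list_nonneg; intros y _.
    apply Rmult_le_pos; [apply Hg | auto]. }
  set (B := boundary_sum K K' v) in *.
  set (s := boundary_sum K K' (fun y => Cnorm2 (w y))) in *.
  set (E := energy (of_real v) (of_real v)) in *.
  apply Rnot_lt_le. intros Hlt.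
  (* With this [h] the loss [h B] is at most half of the supposed gap [s - E]. *)
  assert (He : 0 < (s - E) / 2 / (B + 1)) by (apply Rdiv_lt_0_compat; lra).
  specialize (Hlim _ He). set (h := (s - E) / 2 / (B + 1)) in *.
  assert (h * (B + 1) = (s - E) / 2) by (unfold h; field; lra). nra.
Qed.

(** * Comparison with the maximal form *)

(** Split [u = v + w] with [v = 1_K u]. The part [E(v, v + 2w)] is an explicit finite sum and
    [E(w,w)] is bounded below by the boundary sum; each boundary edge then completes to a square,
    which is dropped. *)
Lemma energy_ge_QN_finite K u : NoDup K -> op_dom S u ->
  sum_list (fun x => sum_list (fun y => / 2 * b x y * Cnorm2 (Csub (u x) (u y))) K) K +
  sum_list (fun x => c x * Cnorm2 (u x)) K <= energy u u.
Proof.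
  intros HK Hu. destruct (neighbours_list K HK) as [K' [Hd Hnb]].
  set (v := fun x => if excluded_middle_informative (In x K) then u x else C0).
  assert (Hin : forall x, In x K -> v x = u x).
  { intros x Hx. unfold v. destruct (excluded_middle_informative (In x K)); tauto. }
  assert (Hout : forall x, ~ In x K -> v x = C0).
  { intros x Hx. unfold v. destruct (excluded_middle_informative (In x K)); tauto. }
  destruct (energy_finite_support K (K ++ K') v HK Hd Hout Hnb) as [Hv Ev].
  set (w := axpy u (-1) v). assert (Hw : op_dom S w) by now apply S_axpy.
  assert (HwK : forall x, In x K -> w x = C0).
  { intros x Hx. unfold w, axpy, C0. rewrite (Hin x Hx). f_equal; ring. }
  assert (HwK' : forall x, ~ In x K -> w x = u x).
  { intros x Hx. unfold w, axpy. rewrite (Hout x Hx). unfold C0; simpl.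
    rewrite (surjective_pairing (u x)) at 3. f_equal; ring. }
  assert (Hbd := energy_boundary K K' w Hd Hnb HwK Hw).
  assert (Eu : energy u u = energy v (axpy v 2 w) + energy w w).
  { replace u with (axpy v 1 w).
    - rewrite energy_axpy, energy_axpy_r by assumption. ring.
    - apply functional_extensionality. intros x. unfold w, axpy; simpl.
      rewrite (surjective_pairing (u x)) at 3. f_equal; ring. }
  rewrite Eu, Ev by now apply S_axpy.
  apply Rle_trans with (2 := Rplus_le_compat_l _ _ _ Hbd).
  rewrite <- sum_list_symmetrize, <- sum_list_add. unfold boundary_sum.
  rewrite <- sum_list_add. apply sum_list_le. intros x Hx. unfold flux.
  rewrite sum_list_app.
  (* On [K] the function [v + 2w] equals [u], so the edges inside [K] give exactly the terms of the
     form of [u]. *)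
  assert (Ex : axpy v 2 w x = u x).
  { unfold axpy. rewrite (HwK x Hx), (Hin x Hx). unfold C0; simpl.
    rewrite (surjective_pairing (u x)) at 3. f_equal; ring. }
  rewrite Ex, (Hin x Hx). change (re_prod (u x) (u x)) with (Cnorm2 (u x)).
  rewrite (sum_list_ext (fun y => b x y * re_prod (Csub (u x) (axpy v 2 w y)) (u x))
     (fun y => b x y * re_prod (Csub (u x) (u y)) (u x)) K).
  2: { intros y Hy. unfold axpy. rewrite (HwK y Hy), (Hin y Hy). unfold C0; simpl.
       unfold re_prod, Csub, Cadd, Copp; simpl. ring. }
  (* For [y] outside [K], [Re ((u(x) - 2u(y)) * conj u(x)) + |u(y)|^2 = |u(x) - u(y)|^2]. *)
  assert (0 <= sum_list (fun y => b x y * re_prod (Csub (u x) (axpy v 2 w y)) (u x)) K' +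
               sum_list (fun y => b x y * Cnorm2 (w y)) K'); [|lra].
  rewrite <- sum_list_add. apply sum_list_nonneg. intros y Hy.
  assert (HyK : ~ In y K) by (intros H; exact (NoDup_app_disjoint K K' y Hd H Hy)).
  unfold axpy. rewrite (Hout y HyK), (HwK' y HyK).
  replace (_ + _) with (b x y * Cnorm2 (Csub (u x) (u y))).
  - apply Rmult_le_pos; [apply Hg | apply Cnorm2_ge0].
  - unfold C0, re_prod, Cnorm2, Csub, Cadd, Copp; simpl. ring.
Qed.

Lemma QN_le_assoc_form : form_le (QN m b c) (assoc_form m S).
Proof.
  intros u Hu. simpl in Hu. destruct Hg as [Hc [Hb _]].
  set (F := fun p : V * V => / 2 * b (fst p) (snd p) * Cnorm2 (Csub (u (fst p)) (u (snd p)))).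
  set (G := fun x => c x * Cnorm2 (u x)).
  assert (HF : forall p, 0 <= F p).
  { intros [x y]. unfold F; simpl. assert (0 <= b x y * Cnorm2 (Csub (u x) (u y))); [|lra].
    apply Rmult_le_pos; [apply Hb | apply Cnorm2_ge0]. }
  assert (HG : forall x, 0 <= G x).
  { intros x. apply Rmult_le_pos; [apply Hc | apply Cnorm2_ge0]. }
  assert (Hfin : forall k l, NoDup k -> NoDup l -> sum_list F k + sum_list G l <= energy u u).
  (* [K] collects both endpoints of all pairs in [k] and the points of [l], so the square over [K]
     contains [k]. *)
  { intros k l Hk Hl. destruct (NoDup_list (map fst k ++ map snd k ++ l)) as [K [HK HKi]].
    apply Rle_trans with (2 := energy_ge_QN_finite K u HK Hu).
    rewrite <- (sum_list_prod F). apply Rplus_le_compat; apply sum_list_incl_le; auto.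
    - now apply NoDup_list_prod.
    - intros [x y] Hp. apply in_prod_iff. rewrite !HKi, !in_app_iff.
      split; [left; exact (in_map fst _ _ Hp) | right; left; exact (in_map snd _ _ Hp)].
    - intros x Hx. apply HKi. rewrite !in_app_iff. auto. }
  split.
  - split; [now apply S_l2|].
    destruct (nnsum_le_exists F (energy u u)) as [s [Hs _]].
    { intros k Hk. specialize (Hfin k nil Hk (NoDup_nil _)). simpl in Hfin. lra. }
    destruct (nnsum_le_exists G (energy u u)) as [t [Ht _]].
    { intros l Hl. specialize (Hfin nil l (NoDup_nil _) Hl). simpl in Hfin. lra. }
    exists (s + t), s, t. auto.
  - intros a a' [s [t [[_ Hs] [[_ Ht] ->]]]] Ha'. apply assoc_form_val in Ha'; [|assumption].
    subst a'. apply Rnot_lt_le. intros Hlt.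
    (* Each of the two sums is approximated to within half of the supposed excess. *)
    destruct (Hs ((s + t - energy u u) / 2)) as [k [Hk1 Hk2]]; [lra|].
    destruct (Ht ((s + t - energy u u) / 2)) as [l [Hl1 Hl2]]; [lra|].
    specialize (Hfin k l Hk1 Hl1). fold F in Hk2. fold G in Hl2. lra.
Qed.

End Graph.

Theorem mainTheorem13 (V : Type) (m : V -> R) (b : V -> V -> R) (c : V -> R)
    (L S : operator V) :
  countable V ->
  is_measure m ->
  is_graph b c ->
  locally_finite b ->
  selfadjoint m L ->
  nonneg_op m L ->
  restricts_formal m b c L ->
  is_sqrt m L S ->
  dirichlet_form m (assoc_form m S) ->
  form_le (QN m b c) (assoc_form m S) /\ form_le (assoc_form m S) (QD m b c).
Proof.
  intros _ Hm Hg Hlf HL _ Hr HS HD. split.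
  - now apply (QN_le_assoc_form Hm Hg Hlf HL Hr HS).
  - now apply (assoc_form_le_QD Hm Hg Hlf HL Hr HS), HD.
Qed.
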